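(* Let $(X,(\varphi_t)_{t\in\mathbb{R}})$ be any flow. Then there exists a map $\phi:X\to L(\mathbb{R})^{\mathbb{N}}$ which is a homeomorphism of $X$ onto its image $\phi(X)$, satisfies $\phi(\varphi_t x)=T_t\phi(x)$ for all $x\in X$ and $t\in\mathbb{R}$, and is such that $\phi(X)\subset (L(\mathbb{R})\cap C^1(\mathbb{R}))^{\mathbb{N}}$; that is, for every $x\in X$, every coordinate of $\phi(x)$ is a $C^1$-function on $\mathbb{R}$.
   Context: A flow is a pair $(X,(\varphi_t)_{t\in\mathbb{R}})$, where $X$ is a compact metric space and $\mathbb{R}\times X\to X$, $(t,x)\mapsto \varphi_t x$, is a continuous action of the additive group $\mathbb{R}$ (so $\varphi_0=\mathrm{id}_X$ and $\varphi_{s+t}=\varphi_s\circ\varphi_t$ for all $s,t\in\mathbb{R}$). $C(\mathbb{R})$ denotes the space of continuous functions $f:\mathbb{R}\to[0,1]$ with the topology of uniform convergence on compact subsets of $\mathbb{R}$, given by the distance $\sum_{n=1}^\infty 2^{-n}\max_{|t|\le n}|f(t)-g(t)|$ for $f,g\in C(\mathbb{R})$. $L(\mathbb{R})\subset C(\mathbb{R})$ denotes the set of all functions $f:\mathbb{R}\to[0,1]$ with $|f(s)-f(t)|\le|s-t|$ for all $s,t\in\mathbb{R}$, with the induced distance. The space $L(\mathbb{R})^{\mathbb{N}}$ (sequences $(f_i)_{i\in\mathbb{N}}$ with $f_i\in L(\mathbb{R})$) carries the product topology. The group $\mathbb{R}$ acts on $L(\mathbb{R})^{\mathbb{N}}$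 by translation in every coordinate: $T_s\big((f_i)_{i\in\mathbb{N}}\big)=\big(f_i(\cdot+s)\big)_{i\in\mathbb{N}}$ for $s\in\mathbb{R}$. $C^1(\mathbb{R})$ denotes the continuously differentiable functions on $\mathbb{R}$; the topology on $(L(\mathbb{R})\cap C^1(\mathbb{R}))^{\mathbb{N}}$ is the subspace topology from $L(\mathbb{R})^{\mathbb{N}}$. *)

(* Defs.v *)
From HB Require Import structures.
From mathcomp Require Import all_boot all_order all_algebra.
From mathcomp Require Import all_classical all_reals all_analysis.

Set Implicit Arguments.
Unset Strict Implicit.
Unset Printing Implicit Defensive.

Import Order.TTheory GRing.Theory Num.Theory.
Import numFieldNormedType.Exports.

Local Open Scope classical_set_scope.
Local Open Scope ring_scope.

Definition is_flow (R : realType) (X : topologicalType) (phi : R -> X -> X) :=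
  [/\ continuous (fun p : R * X => phi p.1 p.2),
      forall x, phi 0 x = x
    & forall s t x, phi (s + t) x = phi s (phi t x)].

(* Functions with values in [0, 1] are represented as real-valued functions
   with a range condition; [{family compact, R -> R}] carries the topology of
   uniform convergence on compact sets. *)
Definition lip01 (R : realType) : set {family compact, R -> R} :=
  [set f | (forall t, 0 <= (f : R -> R) t <= 1) /\
           (forall s t, `|(f : R -> R) s - (f : R -> R) t| <= `|s - t|)].

(* [L(R)] with the subspace topology. *)
Definition LR (R : realType) : Type := set_type (@lip01 R).

HB.instance Definition _ (R : realType) :=
  Topological.copy (LR R) (set_type (@lip01 R)).

Definition LR_fun (R : realType) (f : LR R) : R -> R := set_val f.

(* [L(R)^N] with the product topology. *)
Definition LRN (R : realType) : Type := {ptws nat -> LR R}.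

HB.instance Definition _ (R : realType) :=
  Topological.copy (LRN R) {ptws nat -> LR R}.

Lemma lip01_shift (R : realType) (s : R) (f : LR R) :
  (fun t => LR_fun f (t + s)) \in @lip01 R.
Proof.
have [f01 flip] := set_mem (valP f); apply/mem_set; split => [t|t u].
  exact: f01.
by apply: le_trans (flip _ _) _; rewrite opprD addrACA subrr addr0.
Qed.

Definition LR_shift (R : realType) (s : R) (f : LR R) : LR R :=
  SigSub (lip01_shift s f).

Definition translation (R : realType) (s : R) (F : LRN R) : LRN R :=
  fun i => LR_shift s (F i).

Definition is_C1 (R : realType) (f : R -> R) :=
  (forall t, derivable f t 1) /\ continuous (derive1 f).

Definition homeomorphism (X Y : topologicalType) (f : X -> Y) :=
  continuous f /\
  exists g : Y -> X, [/\ continuous g, cancel f g & cancel g f].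

(* The corestriction of [f] to its image, which has the subspace topology. *)
Definition to_range (X Y : topologicalType) (f : X -> Y) (x : X) :
    set_type (range f) :=
  SigSub (mem_set (imageT f x)).

(* Main.v *)
Require Import Defs.
From HB Require Import structures.
From mathcomp Require Import all_boot all_order all_algebra.
From mathcomp Require Import all_classical all_reals all_analysis.

Import Order.TTheory GRing.Theory Num.Theory.
Import numFieldNormedType.Exports.

Local Open Scope classical_set_scope.
Local Open Scope ring_scope.

(** Integrating along the flow over a forward time window turns a continuous observable
[h : X -> [0, 1]] into one whose restriction to every orbit is differentiable:
if [P] is a primitive of [s |-> h (phi s x)], the function
[t |-> \int_(s in [0, a]) h (phi s (phi t x))] equals [P (t + a) - P t]
([window_integralE]).  Its derivative [h (phi (t + a) x) - h (phi t x)] is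
continuous in [t] and lies in [-1, 1], and for [a <= 1] its values lie in
[0, 1].  So no rescaling is needed: the orbit functions of these integrals are
[C^1] elements of the space of 1-Lipschitz functions ([window_orbit_C1],
[window_orbit_lip01]), and following an orbit is translating the function.

The coordinates of the embedding are these functions, for [h] in a countable
family of observables separating the points of [X] ([separating_family]) and
for the widths [a = 1 / (k + 1)].  By the mean value theorem the integral over
[0, a] is [a] times a value of [h] on the orbit segment, so letting the width
tend to 0 recovers [h x]; hence the coordinates separate points
([window_integrals_separate]).  They depend continuously on [x], because [h (phi s x)]
is continuous in [x] uniformly for [s] in a compact time interval
([window_integral_continuous]), and joint continuity in [x] and [t] is enough
for continuity into the space of functions with uniform convergence on compact
sets ([continuous_into_LRN]).  Finally a continuous injection of a compact space
into a Hausdorff space is a homeomorphism onto its image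
([compact_embedding]). *)

(** * Primitives and the mean value theorem *)

Lemma continuous_integrable_itvcc {R : realType} (u : R -> R) (a b : R) :
  continuous u ->
  lebesgue_measure.-integrable `[a, b] (EFin \o u).
Proof.
move=> cu; apply: continuous_compact_integrable; first exact: segment_compact.
exact: continuous_subspaceT.
Qed.

(** The integrals from [- m], normalised to vanish at 0, agree for all [m >= 0] at
every point of [`[- m, +oo[].  The bound [m = `|s| + 1] used at [s] is at most
[`|t| + 2] when [s] is within distance 1 of [t], so that near [t] a single [m]
serves for the derivative. *)
Lemma primitive_exists {R : realType} (u : R -> R) : continuous u ->
  exists P : R -> R, forall t : R, is_derive t 1 P (u t).
Proof.
move=> cu; have iu a b := @continuous_integrable_itvcc R u a b cu.
pose Q (m t : R) := (\int[lebesgue_measure]_(s in `[- m, t]) u s)%R.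
pose Q0 m t := Q m t - Q m 0.
have QB (m m' t : R) : m <= m' -> - m <= t -> Q m' t - Q m' (- m) = Q m t.
  move=> mm' mt; rewrite /Q Rintegral_itvB//= ?bnd_simp ?lerN2//.
  rewrite Rintegral_itv_obnd_cbnd//.
  by apply: integrableS (iu (- m) t) => //; exact: subset_itv_oc_cc.
have Q0E (m m' t : R) : 0 <= m -> m <= m' -> - m <= t -> Q0 m' t = Q0 m t.
  move=> m0 mm' mt; rewrite /Q0 -(QB m m' t)// -(QB m m' 0) ?oppr_le0//.
  by rewrite opprB addrA subrK.
exists (fun t => Q0 (`|t| + 1) t) => t.
have tm : - (`|t| + 2) < t.
  by rewrite ltrNl (le_lt_trans (ler_norm _))// normrN ltrDl.
have dQ : is_derive t 1 (Q0 (`|t| + 2)) (u t).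
  have [] := @continuous_FTC1_closed R u (- (`|t| + 2)) t (t + 1) _ (iu _ _) tm
    (cu t).
    by rewrite ltrDl.
  rewrite derive1E => dQ dQE; rewrite -[u t]subr0 -dQE.
  by apply: is_deriveB; exact: derivableP.
apply: near_eq_is_derive dQ; near=> s.
have st : `|t - s| < 1.
  by near: s; apply: cvgr_dist_lt => //; exact: cvg_id.
apply: Q0E; first by rewrite addr_ge0.
- have -> : s = t - (t - s) by rewrite subKr.
  rewrite (le_trans (lerD (ler_normB _ _) (lexx _)))// -addrA lerD2l.
  by rewrite -[2]/(1 + 1) lerD2r ltW.
- by rewrite lerNl (le_trans (ler_norm _))// normrN lerDl.
Unshelve. all: by end_near. Qed.

Lemma mean_value {R : realType} (P u : R -> R) (a b : R) : a < b ->
  (forall t : R, is_derive t 1 P (u t)) ->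
  exists2 c, a < c < b & P b - P a = u c * (b - a).
Proof.
move=> ab dP.
have cP : {within `[a, b], continuous P}.
  by apply: derivable_within_continuous => t _; case: (dP t).
by have [c cab PE] := MVT ab (fun t _ => dP t) cP; exists c.
Qed.

Lemma is_derive_translate {R : realType} (P : R -> R) (s t d : R) :
  is_derive (t + s) 1 P d -> is_derive t 1 (fun r => P (r + s)) d.
Proof.
move=> dP; rewrite -[d]mulr1.
exact: (@is_derive1_comp R P (shift s) t d 1 dP (is_derive_shift _ _ _)).
Qed.

(** * Topology of compact spaces and of the function space *)

(** Two points that cannot be separated by neighbourhoods have images that cannot
be separated either, for every [e i]. *)
Lemma hausdorff_separating {T Y : topologicalType} {I : Type} (e : I -> T -> Y) :
  hausdorff_space Y -> (forall i, continuous (e i)) ->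
  (forall p q, (forall i, e i p = e i q) -> p = q) -> hausdorff_space T.
Proof.
move=> hY ce sep p q pq; apply: sep => i; apply: hY => A B Ap Bq.
have [z [Az Bz]] := pq _ _ (ce i _ _ Ap) (ce i _ _ Bq).
by exists (e i z).
Qed.

(** A closed subset of [T] is compact, so its image is compact, hence closed: this
is the continuity of the inverse. *)
Lemma compact_embedding {T Y : topologicalType} (f : T -> Y) :
  compact [set: T] -> hausdorff_space Y -> continuous f -> injective f ->
  homeomorphism (to_range f).
Proof.
move=> cT hY cf f_inj; split; first exact: continuous_comp_initial.
pose g (y : set_type (range f)) : T := projT1 (cid2 (set_mem (valP y))).
have gK y : f (g y) = set_val y by rewrite /g; case: cid2.
exists g; split.
- apply/continuous_closedP => A clA.
  have cfA : closed (f @` A).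
    apply: compact_closed => //; apply: continuous_compact.
      exact: continuous_subspaceT.
    exact: subclosed_compact clA cT _.
  have -> : g @^-1` A = set_val @^-1` (f @` A).
    apply/seteqP; split=> [y Agy|y [x Ax fxy]]; first by exists (g y).
    by rewrite /= (_ : g y = x)//; apply: f_inj; rewrite gK.
  by apply: closed_comp => // y _; exact: initial_continuous.
- by move=> x; apply: f_inj; rewrite gK.
- by move=> y; apply: val_inj; rewrite /= gK.
Qed.

Lemma LRN_eval_continuous {R : realType} (i : nat) (t : R) :
  continuous (fun F : LRN R => LR_fun (F i) t).
Proof.
have cproj : continuous (fun F : LRN R => F i) by exact: proj_continuous.
have cval : continuous (fun f : LR R => set_val f : {family compact, R -> R}).
  exact: initial_continuous.
have ceval : continuous (fun f : {family compact, R -> R} => (f : R -> R) t).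
  move=> f; have fam : {family compact, nbhs f --> (f : R -> R)} by exact: cvg_id.
  have Ff : Filter (nbhs f) by exact: nbhs_filter.
  have pw := @pointwise_cvg_compact_family R R (nbhs f) f Ff fam.
  have pt := (@pointwise_cvgP R R (nbhs f) f Ff).1 pw t.
  exact: pt.
move=> F.
exact: (continuous_comp (cproj F) (continuous_comp (@cval _) (@ceval _))).
Qed.

Lemma LRN_hausdorff {R : realType} : hausdorff_space (LRN R).
Proof.
apply: (@hausdorff_separating (LRN R) R (nat * R)
  (fun it F => LR_fun (F it.1) it.2)).
- exact: Rhausdorff.
- by move=> it; exact: LRN_eval_continuous.
- move=> F G FG; apply/funext => i; apply: val_inj; apply/funext => t.
  exact: (FG (i, t)).
Qed.

(** Uniform convergence on compact sets is convergence in the compact-open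
topology, for which currying preserves continuity. *)
Lemma continuous_into_LRN {R : realType} {X : topologicalType} (f : X -> LRN R) :
  (forall i, continuous (fun p : X * R => LR_fun (f p.1 i) p.2)) ->
  continuous f.
Proof.
move=> cf x; apply/cvg_sup => i; move: x.
apply: (@continuous_comp_initial (LRN R) X (LR R) (fun g => g i)).
apply: continuous_comp_initial => x.
have [] := @continuous_curry X R R _ (cf i).
move=> /(_ x) cc cx.
apply/compact_open_fam_compactP; first exact: cx.
exact: cc.
Qed.

(** * Countable separating families on a compact metric space *)

Lemma mdist_continuous {R : realType} {X : metricType R} (c : X) :
  continuous (fun x : X => mdist x c).
Proof.
move=> x; apply/cvgrPdist_lt => e e0; near=> y.
have xy : mdist x y < e.
  by near: y; have := nbhsx_ballx x _ e0; rewrite ballEmdist.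
apply: le_lt_trans xy; rewrite ler_norml lerBlDr lerBrDr.
rewrite metric_triangle andbT addrC lerBlDr (metric_sym x y).
by rewrite addrC metric_triangle.
Unshelve. all: by end_near. Qed.

(** Compactness is used as a covering property relative to the filter of all large
enough finite sets of centers, which applies also when [X] is empty. *)
Lemma compact_finite_nets {R : realType} {X : metricType R} :
  compact [set: X] ->
  exists s : nat -> seq X, forall n x,
    exists2 c, c \in s n & mdist x c < n.+1%:R^-1.
Proof.
move=> cX.
suff net n : exists s : seq X, forall x,
    exists2 c, c \in s & mdist x c < n.+1%:R^-1.
  by have [s sP] := choice net; exists s.
pose F := filter_from [set: seq X] (fun s => [set s' : seq X | {subset s <= s'}]).
have FF : Filter F.
  apply: filter_from_filter; first by exists [::].
  move=> s1 s2 _ _; exists (s1 ++ s2) => // s /= s12.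
  by split=> c cs; apply: s12; rewrite mem_cat cs ?orbT.
have n0 : 0 < n.+1%:R^-1 :> R by rewrite invr_gt0.
have [|s _ sP] := (compact_near_coveringP [set: X]).1 cX (seq X) F
  (fun s x => exists2 c, c \in s & mdist x c < n.+1%:R^-1) FF.
- move=> x _; exists (ball x n.+1%:R^-1, [set s | x \in s]).
    split; first exact: nbhsx_ballx.
    by exists [:: x] => // s; apply; rewrite mem_head.
  case=> y s /= [xy xs]; exists x => //.
  by move: xy; rewrite ballEmdist /= metric_sym.
- by exists s => x; exact: sP.
Qed.

(** The truncated distances to the points of finite nets of radius [1 / (n + 1)]:
a center close to [x] and at the same truncated distance from [y] is also close
to [y].  The index [(n, i)] stands for the [i]-th center of the [n]-th net, with
the zero function as a default when there is no such center. *)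
Lemma separating_family {R : realType} {X : metricType R} :
  compact [set: X] ->
  exists h : nat * nat -> X -> R,
    [/\ forall i, continuous (h i), forall i x, 0 <= h i x <= 1
      & forall x y, (forall i, h i x = h i y) -> x = y].
Proof.
move=> /compact_finite_nets[s sP].
exists (fun ni x => oapp (fun c => Num.min 1 (mdist x c)) 0 (onth (s ni.1) ni.2)).
split.
- case=> n i /=; case: onth => [c|] /=; last exact: cst_continuous.
  move=> x; apply: (@continuous_min R X (fun=> 1) (mdist^~ c) x).
    exact: cst_continuous.
  exact: mdist_continuous.
- move=> [n i] x /=; case: onth => [c|] /=; last by rewrite lexx ler01.
  by rewrite le_min ler01 mdist_ge0 ge_min lexx.
- move=> x y hxy; apply/eqP; rewrite -[_ == _]negbK -mdist_gt0.
  apply/negP => xy0.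
  have e0 : 0 < Num.min 1 (mdist x y / 2) by rewrite lt_min ltr01 divr_gt0.
  have [n _ /(_ n (leqnn n)) /=] := near_infty_natSinv_lt (PosNum e0).
  rewrite lt_min => /andP[n1 nxy].
  have [c cs xc] := sP n x.
  have [i ci] := onthP cs.
  have := hxy (n, i); rewrite /= ci /= (min_idPr (ltW (lt_trans xc n1))) => xcE.
  have yc : mdist y c < n.+1%:R^-1.
    by move: xc; rewrite xcE gt_min ltNge (ltW n1).
  have := metric_triangle x c y; rewrite (metric_sym c y) leNgt => /negP; apply.
  by rewrite [ltRHS]splitr ltrD// (lt_trans _ nxy).
Qed.

(** * Integrals of an observable over a window of the flow *)

Lemma orbit_continuous {R : realType} {X : topologicalType} (phi : R -> X -> X)
    (h : X -> R) (x : X) :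
  is_flow phi -> continuous h -> continuous (fun s => h (phi s x)).
Proof.
move=> [cphi _ _] ch s.
have cpair : {for s, continuous (fun r : R => (r, x))}.
  by apply: (@cvg_pair _ _ _ (nbhs s) (nbhs s) (nbhs x));
    [exact: cvg_id|exact: cvg_cst].
exact: (continuous_comp (continuous_comp cpair (cphi (s, x))) (ch (phi s x))).
Qed.

Definition window_integral {R : realType} {X : Type} (phi : R -> X -> X)
    (h : X -> R) (a : R) (x : X) : R :=
  (\int[lebesgue_measure]_(s in `[0, a]) h (phi s x))%R.

(** A translate of [P] is a primitive along the orbit of [phi t x], so the
fundamental theorem of calculus applies to it; every later property of
[window_integral] follows from this formula and the mean value theorem. *)
Lemma window_integralE {R : realType} {X : topologicalType}
    (phi : R -> X -> X) (h : X -> R) (a : R) (x : X) (P : R -> R) :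
  is_flow phi -> continuous h -> 0 < a ->
  (forall s : R, is_derive s 1 P (h (phi s x))) ->
  forall t, window_integral phi h a (phi t x) = P (t + a) - P t.
Proof.
move=> fphi ch a0 dP t; have [_ _ phiD] := fphi.
pose Pt s := P (s + t).
have dPt (s : R) : is_derive s 1 Pt (h (phi s (phi t x))).
  by apply: is_derive_translate; rewrite -phiD.
have cPt : continuous Pt.
  by move=> s; apply/differentiable_continuous/derivable1_diffP; case: (dPt s).
have FTC : (\int[lebesgue_measure]_(s in `[0%R, a]) (h (phi s (phi t x)))%:E =
    (Pt a)%:E - (Pt 0%R)%:E)%E.
  apply: continuous_FTC2 => //.
  - have := orbit_continuous phi h (phi t x) fphi ch; exact: continuous_subspaceT.
  - split.
    + by move=> s _; case: (dPt s).
    + exact: cvg_at_right_filter (cPt 0).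
    + exact: cvg_at_left_filter (cPt a).
  - by move=> s _; rewrite derive1E; case: (dPt s).
by rewrite /window_integral /Rintegral FTC /= /Pt add0r [a + t]addrC.
Qed.

Lemma window_integral_mean {R : realType} {X : topologicalType}
    (phi : R -> X -> X) (h : X -> R) (a : R) (x : X) :
  is_flow phi -> continuous h -> 0 < a ->
  exists2 s, 0 < s < a & window_integral phi h a x = h (phi s x) * a.
Proof.
move=> fphi ch a0.
have [P dP] := primitive_exists _ (orbit_continuous phi h x fphi ch).
have [s s0a PE] := mean_value _ _ _ _ a0 dP.
exists s => //; have [_ phi0 _] := fphi.
by rewrite -[in LHS](phi0 x) (window_integralE _ _ _ _ P)// add0r PE subr0.
Qed.

Lemma observable_joint_continuous {R : realType} {X : topologicalType}
    (phi : R -> X -> X) (h : X -> R) :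
  is_flow phi -> continuous h -> continuous (fun p : R * X => h (phi p.1 p.2)).
Proof.
by move=> [cphi _ _] ch p; exact: (continuous_comp (cphi p) (ch _)).
Qed.

(** By the mean value theorem for the difference of two primitives, the integrals
at [x] and [y] differ by [a] times a difference of observed values, which is
uniformly small on [0, a] when [y] is close to [x], by compactness of [0, a]. *)
Lemma window_integral_continuous {R : realType} {X : topologicalType}
    (phi : R -> X -> X) (h : X -> R) (a : R) :
  is_flow phi -> continuous h -> 0 < a -> continuous (window_integral phi h a).
Proof.
move=> fphi ch a0 x; apply/cvgrPdist_lt => e e0.
have prim y := primitive_exists _ (orbit_continuous phi h y fphi ch).
have [_ phi0 _] := fphi.
have unif : \forall y \near x, `[0, a] `<=`
    [set s | `|h (phi s x) - h (phi s y)| < e / a].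
  have /compact_near_coveringP cov := @segment_compact R 0 a.
  apply: (cov X (nbhs x) (fun y s => `|h (phi s x) - h (phi s y)| < e / a)) => s _.
  have cdiff : {for (s, x), continuous
      (fun p : R * X => h (phi p.1 x) - h (phi p.1 p.2))}.
    apply: cvgB; last exact: (observable_joint_continuous phi h fphi ch).
    have cu := orbit_continuous phi h x fphi ch s.
    exact: (@continuous_comp _ _ _ fst (fun r => h (phi r x)) (s, x) cvg_fst cu).
  move: cdiff => /cvgrPdist_lt /(_ (e / a) (divr_gt0 e0 a0)) /=.
  by rewrite subrr; apply: filterS => p; rewrite sub0r normrN.
near=> y.
have [P dP] := prim x; have [Q dQ] := prim y.
have dPQ (s : R) : is_derive s 1 (P - Q) (h (phi s x) - h (phi s y)).
  exact: is_deriveB.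
have -> : window_integral phi h a x - window_integral phi h a y =
    (P - Q) a - (P - Q) 0.
  rewrite -[in LHS](phi0 x) -[in LHS](phi0 y).
  rewrite (window_integralE _ _ _ _ P)// (window_integralE _ _ _ _ Q)// !add0r.
  rewrite -[(P - Q) a]/(P a - Q a) -[(P - Q) 0]/(P 0 - Q 0).
  by rewrite !opprD addrACA.
have [c /andP[c0 ca] ->] := mean_value _ _ _ _ a0 dPQ.
rewrite subr0 normrM (gtr0_norm a0) -ltr_pdivlMr//.
have : `[0, a] `<=` [set s | `|h (phi s x) - h (phi s y)| < e / a] by near: y.
by apply; rewrite /= in_itv /= !ltW.
Unshelve. all: by end_near. Qed.

Lemma window_orbit_derive {R : realType} {X : topologicalType}
    (phi : R -> X -> X) (h : X -> R) (a : R) (x : X) :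
  is_flow phi -> continuous h -> 0 < a ->
  forall t : R, is_derive t 1 (fun t => window_integral phi h a (phi t x))
    (h (phi (t + a) x) - h (phi t x)).
Proof.
move=> fphi ch a0 t.
have [P dP] := primitive_exists _ (orbit_continuous phi h x fphi ch).
rewrite (_ : (fun _ => _) = (fun t => P (t + a)) - P); last first.
  by apply/funext => s; rewrite (window_integralE _ _ _ _ P).
by apply: is_deriveB; exact: is_derive_translate.
Qed.

Lemma window_orbit_C1 {R : realType} {X : topologicalType}
    (phi : R -> X -> X) (h : X -> R) (a : R) (x : X) :
  is_flow phi -> continuous h -> 0 < a ->
  is_C1 (fun t => window_integral phi h a (phi t x)).
Proof.
move=> fphi ch a0; have dW := window_orbit_derive phi h a x fphi ch a0.
split=> [t|]; first by case: (dW t).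
rewrite (_ : derive1 _ = fun t => h (phi (t + a) x) - h (phi t x)); last first.
  by apply/funext => t; rewrite derive1E; case: (dW t).
have cu := orbit_continuous phi h x fphi ch.
move=> t; apply: cvgB; last exact: cu.
have ct : {for t, continuous (fun r : R => r + a)}.
  by apply: cvgD; [exact: cvg_id|exact: cvg_cst].
exact: (@continuous_comp _ _ _ (fun r => r + a) (fun r => h (phi r x)) t ct (cu _)).
Qed.

(** The derivative is a difference of two numbers of [0, 1], and the integral is
[a <= 1] times a number of [0, 1]. *)
Lemma window_orbit_lip01 {R : realType} {X : topologicalType}
    (phi : R -> X -> X) (h : X -> R) (a : R) (x : X) :
  is_flow phi -> continuous h -> (forall y, 0 <= h y <= 1) -> 0 < a <= 1 ->
  (fun t => window_integral phi h a (phi t x)) \in @lip01 R.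
Proof.
move=> fphi ch h01 /andP[a0 a1]; apply/mem_set; split.
  move=> t; have [s _ ->] := window_integral_mean phi h a (phi t x) fphi ch a0.
  have /andP[h0 h1] := h01 (phi s (phi t x)).
  by rewrite mulr_ge0 ?(ltW a0)//= mulr_ile1 ?(ltW a0).
have dW := window_orbit_derive phi h a x fphi ch a0.
move=> s t; wlog st : s t / s < t.
  move=> ih; have [|ts|->] := ltgtP s t; first exact: ih.
    by rewrite distrC [leRHS]distrC; exact: ih.
  by rewrite !subrr.
rewrite distrC [leRHS]distrC.
have [c _ ->] := mean_value _ _ _ _ st dW.
rewrite normrM ler_piMl// ler_norml.
have /andP[u0 u1] := h01 (phi (c + a) x); have /andP[v0 v1] := h01 (phi c x).
apply/andP; split; first by rewrite lerBrDr addrC (le_trans _ u0)// subr_le0.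
by rewrite lerBlDr (le_trans u1)// lerDl.
Qed.

(** The integral over [0, a] is [a] times [h] at some time [s < a], so equal
integrals give equal values of [h] at points arbitrarily close to [x] and [y]. *)
Lemma window_integrals_separate {R : realType} {X : topologicalType}
    (phi : R -> X -> X) (h : X -> R) (x y : X) :
  is_flow phi -> continuous h ->
  (forall k : nat, window_integral phi h k.+1%:R^-1 x =
                   window_integral phi h k.+1%:R^-1 y) ->
  h x = h y.
Proof.
move=> fphi ch xyE; have [_ phi0 _] := fphi.
apply/eqP; rewrite -subr_eq0 -normr_le0; apply/ler_addgt0Pl => e e0.
rewrite addr0.
have e20 : 0 < e / 2 by rewrite divr_gt0.
have near0 z : \forall s \near (0 : R), `|h z - h (phi s z)| < e / 2.
  have := orbit_continuous phi h z fphi ch 0.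
  by move=> /cvgrPdist_lt /(_ _ e20); rewrite phi0.
have [/= d /= d0 close] := filterI (near0 x) (near0 y).
have [k _ /(_ k (leqnn k)) /= kd] := near_infty_natSinv_lt (PosNum d0).
have k0 : 0 < k.+1%:R^-1 :> R by rewrite invr_gt0.
have in_ball s : 0 < s < k.+1%:R^-1 -> ball (0 : R) d s.
  move=> /andP[s0 sk]; rewrite /ball /= sub0r normrN gtr0_norm//.
  exact: lt_trans sk kd.
have [s /in_ball sd sE] := window_integral_mean phi h _ x fphi ch k0.
have [r /in_ball rd rE] := window_integral_mean phi h _ y fphi ch k0.
have hE : h (phi s x) = h (phi r y).
  by apply: (mulIf (lt0r_neq0 k0)); rewrite -sE -rE.
have [xs _] := close s sd; have [_ yr] := close r rd.
rewrite -(subrKA (h (phi s x))) (le_trans (ler_normD _ _))//.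
by rewrite [leRHS]splitr lerD//; [exact: ltW|rewrite hE distrC; exact: ltW].
Qed.

(** * The embedding *)

Theorem mainTheorem2 (R : realType) (X : metricType R)
    (phi : R -> X -> X) :
  compact [set: X] -> is_flow phi ->
  exists Phi : X -> LRN R,
    [/\ homeomorphism (to_range Phi),
        forall x t, Phi (phi t x) = translation t (Phi x)
      & range Phi `<=` [set F : LRN R | forall i, is_C1 (LR_fun (F i))]].
Proof.
move=> cX fphi; have [h [ch h01 hsep]] := separating_family cX.
pose width (k : nat) : R := k.+1%:R^-1.
have width01 k : 0 < width k <= 1.
  by rewrite invr_gt0 ltr0Sn invf_le1 ?ler1n.
have width0 k : 0 < width k by case/andP: (width01 k).
(* The default index (0, 0, 0) only duplicates a coordinate. *)
pose index (j : nat) : nat * nat * nat := odflt (0, 0, 0)%N (unpickle j).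
pose W (j : nat) : X -> R :=
  window_integral phi (h (index j).1) (width (index j).2).
pose Phi (x : X) : LRN R := fun j =>
  SigSub (window_orbit_lip01 phi (h (index j).1) (width (index j).2) x fphi
    (ch _) (h01 _) (width01 _)) : LR R.
have PhiE x j t : LR_fun (Phi x j) t = W j (phi t x) by [].
have [_ phi0 phiD] := fphi.
exists Phi; split.
- apply: compact_embedding => //; first exact: LRN_hausdorff.
  + apply: continuous_into_LRN => j.
    have cW : continuous (W j) by exact: window_integral_continuous.
    have := observable_joint_continuous phi (W j) fphi cW.
    move=> c p; apply: (continuous_comp (@swap_continuous _ _ p) (c _)).
  + move=> x y xyE; apply: hsep => i.
    apply: (window_integrals_separate phi (h i) x y fphi (ch i)) => k.
    have /(congr1 (fun F : LRN R => LR_fun (F (pickle (i, k))) 0)) := xyE.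
    by rewrite /= !PhiE !phi0 /W /index pickleK.
- move=> x t; apply/funext => j; apply: val_inj; apply/funext => s /=.
  by rewrite -[RHS]/(LR_fun (Phi x j) (s + t)) PhiE phiD.
- by move=> _ [x _ <-] j; exact: window_orbit_C1.
Qed.
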